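(* Let $(L,\vee,\wedge,0,1)$ be a complete lattice satisfying the infinite distributive law $$x\wedge\bigvee_{\alpha\in\Omega}y_\alpha=\bigvee_{\alpha\in\Omega}(x\wedge y_\alpha)$$ for every $x\in L$, every index set $\Omega$ and every family $(y_\alpha)_{\alpha\in\Omega}$ in $L$. Then the poset $(\mathrm{DO}(L),\preceq)$ of all derivations on $L$, with bottom $\mathbf{0}_L$ and top $\mathrm{Id}_L$, is a complete lattice.
   Context: A derivation on a bounded lattice $L$ is a map $d:L\to L$ with $d(x\wedge y)=(d(x)\wedge y)\vee(x\wedge d(y))$ for all $x,y\in L$; $\mathrm{DO}(L)$ is the set of all derivations on $L$. For $d,d'\in\mathrm{DO}(L)$, write $d\preceq d'$ if $d(x)\leq d'(x)$ for all $x\in L$. $\mathbf{0}_L$ denotes the constant map with value $0$ and $\mathrm{Id}_L$ the identity map on $L$. A lattice is complete if every subset has a supremum and an infimum. *)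

(* Defs.v *)
From HB Require Import structures.
From mathcomp Require Import all_boot all_order.
From mathcomp Require Import boolp classical_sets.

Set Implicit Arguments.
Unset Strict Implicit.
Unset Printing Implicit Defensive.

Import Order.Theory.
Local Open Scope classical_set_scope.
Local Open Scope order_scope.

(* supremums A and infimums A are the sets of least upper bounds and greatest
   lower bounds of A; A may be empty. *)
Definition is_complete_lattice disp (P : porderType disp) : Prop :=
  forall A : set P, supremums A !=set0 /\ infimums A !=set0.

(* Stated relationally, since the library has no total supremum operator for
   families: whenever s is the supremum of the y_a, the meet of x and s is the
   supremum of the meets of x with the y_a. The infix operators inside
   supremums are lattice operations (order_scope), not set operations. *)
Definition infinite_distributive disp (L : latticeType disp) : Prop :=
  forall (x : L) (I : Type) (y : I -> L) (s : L),
    supremums (range y) s ->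
    supremums (range (fun a => x `&` y a)) (x `&` s).

Definition is_derivation disp (L : latticeType disp) (f : L -> L) : Prop :=
  forall x y : L, f (x `&` y) = (f x `&` y) `|` (x `&` f y).

Record DO disp (L : latticeType disp) : Type := MkDO {
  DO_fun :> L -> L;
  DO_subproof : `[< is_derivation DO_fun >]
}.

(* The order is the one inherited from L -> L, which is pointwise. *)
Section DerivationOrder.
Context (disp : Order.disp_t) (L : latticeType disp).

HB.instance Definition _ := [isSub for @DO_fun disp L].
HB.instance Definition _ := [Choice of DO L by <:].
HB.instance Definition _ := [SubChoice_isSubPOrder of DO L by <:
  with FunOrder.fun_display].

Lemma DO_leP (f g : DO L) : reflect (forall x, f x <= g x) (f <= g).
Proof. by rewrite leEsub; exact: lefP. Qed.

End DerivationOrder.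

Section BoundedDerivations.
Context (disp : Order.disp_t) (L : tbLatticeType disp).

Lemma zero_is_derivation : is_derivation (fun _ : L => \bot).
Proof. by move=> x y; rewrite meet0x meetx0 joinxx. Qed.

Definition DO_zero : DO L := MkDO (asboolT zero_is_derivation).

Lemma id_is_derivation : is_derivation (@id L).
Proof. by move=> x y; rewrite joinxx. Qed.

Definition DO_id : DO L := MkDO (asboolT id_is_derivation).

End BoundedDerivations.

Arguments DO_zero {disp} L.
Arguments DO_id {disp} L.

(* Main.v *)
Require Import Defs.
From mathcomp Require Import all_boot all_order.
From mathcomp Require Import boolp classical_sets.

Import Order.Theory.
Local Open Scope classical_set_scope.
Local Open Scope order_scope.

(** The bounds hold because a derivation is deflationary: taking [y = x] in
    the defining identity gives [d x = d x `&` x]. Completeness holds because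
    the infinite distributive law makes the pointwise supremum of any family
    of derivations a derivation ([derivation_pointwise_sup]), so every set of
    derivations has a supremum; the infimum of a set is then the supremum of
    the set of its lower bounds ([sup_complete_is_complete]). *)

Lemma derivation_le {disp} {L : latticeType disp} {f : L -> L} :
  is_derivation f -> forall x, f x <= x.
Proof. by move=> df x; rewrite -{1}(meetxx x) df meetC joinxx leIl. Qed.

Lemma sup_complete_is_complete {disp} {P : porderType disp} :
  (forall A : set P, supremums A !=set0) -> is_complete_lattice P.
Proof.
move=> supP A; split; first exact: supP.
have [s [s_ub s_least]] := supP (lbound A).
exists s; split=> [x Ax | y]; last exact: s_ub.
by apply: s_least => y; apply.
Qed.

Lemma derivation_pointwise_sup {disp} {L : latticeType disp} {I : Type}
    {d : I -> L -> L} {f : L -> L} :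
  infinite_distributive L -> (forall i, is_derivation (d i)) ->
  (forall x, supremums (range (fun i => d i x)) (f x)) -> is_derivation f.
Proof.
move=> distr der supf x y.
have [ubxy leastxy] := supf (x `&` y).
have [ubl leastl] := distr y _ _ _ (supf x).
have [ubr leastr] := distr x _ _ _ (supf y).
apply: le_anti; apply/andP; split.
  apply: leastxy => _ [i _ <-].
  rewrite der leU2 //; last by apply: ubr; exists i.
  by rewrite (meetC (d i x)) (meetC (f x)); apply: ubl; exists i.
have le_sup i : (d i x `&` y) `|` (x `&` d i y) <= f (x `&` y).
  by rewrite -der; apply: ubxy; exists i.
rewrite leUx (meetC (f x)); apply/andP; split.
  apply: leastl => _ [i _ <-].
  by rewrite meetC; apply: le_trans (le_sup i); rewrite leUl.
apply: leastr => _ [i _ <-].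
by apply: le_trans (le_sup i); rewrite leUr.
Qed.

Lemma DO_has_sup {disp} {L : latticeType disp} :
  is_complete_lattice L -> infinite_distributive L ->
  forall A : set (DO L), supremums A !=set0.
Proof.
move=> compl distr A.
pose d (i : {f : DO L | A f}) : L -> L := sval i.
have der i : is_derivation (d i) by apply/asboolP; exact: DO_subproof.
have /choice[f supf] : forall x, exists s, supremums (range (fun i => d i x)) s.
  by move=> x; have [] := compl (range (fun i => d i x)).
exists (MkDO (asboolT (derivation_pointwise_sup distr der supf))).
split=> [g Ag | h h_ub]; apply/DO_leP => x /=; have [ubf leastf] := supf x.
  by apply: ubf; exists (exist _ g Ag).
by apply: leastf => _ [[g Ag] _ <-]; apply/DO_leP/h_ub.
Qed.

Theorem theorem4p7 (disp : Order.disp_t) (L : tbLatticeType disp)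
    (L_complete : is_complete_lattice L)
    (L_infdistr : infinite_distributive L) :
  [/\ forall f : DO L, DO_zero L <= f,
      forall f : DO L, f <= DO_id L
    & is_complete_lattice (DO L)].
Proof.
split=> [f | f |].
- by apply/DO_leP => x; exact: le0x.
- by apply/DO_leP => x; apply: derivation_le; apply/asboolP/DO_subproof.
- exact/sup_complete_is_complete/DO_has_sup.
Qed.
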